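(* The set $U_{FM}(T,E)$ of frequently universal generalized harmonic functions is a dense subset of $H(T,E)$. Under the additional assumption that $\sum_{y\in S(x)}w(x,y)=1$ for all $x\in T$, the set $U_{FM}(T,E)\cup\{0\}$ contains a vector space (over $\mathbb{F}$) that is dense in $H(T,E)$, and $U_{FM}(T,E)$ is disjoint from a $G_\delta$ and dense subset of $H(T,E)$.
   Context: Tree. $T=\bigcup_{n=0}^\infty T_n$ is the vertex set of a rooted tree; $T_n$ is the (finite) set of vertices at level $n$, the $T_n$ are pairwise disjoint, $T_0=\{x_0\}$. Every $x\in T_n$ has a set of children $S(x)\subset T_{n+1}$ with at least two elements, and $(S(x))_{x\in T_n}$ is a partition of $T_{n+1}$. Field and vector space. $\mathbb{F}$ is a field with a separable Hausdorff topology for which addition and the inverse function are continuous. $E$ is a separable topological vector space over $\mathbb{F}$ whose topology is induced by a translation invariant metric $d$; $(E,d)$ is not assumed complete. Generalized harmonic functions. For every $x\in T$ and $y\in S(x)$ an element $w(x,y)\in\mathbb{F}\setminus\{0\}$ is fixed. $H(T,E)$ is the set of functions $f:T\to E$ with $f(x)=\sum_{y\in S(x)}w(x,y)f(y)$ for all $x\in T$. It carries the subspace topology from $E^T$ with the product topology (induced by the metric $\rho(f,g)=\sum_{n=0}^\infty 2^{-n}\frac{d(f(x_n),g(x_n))}{1+d(f(x_n),g(x_n))}$, where $(x_n)_{n\ge 0}$ is a fixed enumeration of $T$). Boundary and measure. Real weights $q(x,y)\ge 0$ ($x,y\in T$) are given with $q(x,y)>0$ if and only if $y\in S(x)$, and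 $\sum_{y\in S(x)}q(x,y)=1$ for all $x$. The boundary $\partial T$ is the set of all infinite geodesics $e=\{z_n:n\ge 0\}$ with $z_0=x_0$ and $z_{n+1}\in S(z_n)$. For $x\in T$, $B_x=\{e\in\partial T: x\in e\}$. $M_n$ is the $\sigma$-algebra on $\partial T$ generated by $\{B_x\}_{x\in T_n}$, and $M$ is the $\sigma$-algebra generated by $\bigcup_n M_n$. $\mathbb{P}$ is the unique probability measure on $M$ such that for $x\in T_n$, $\mathbb{P}(B_x)=\prod_{j=0}^{n-1}q(y_j,y_{j+1})$, where $x_0=y_0,y_1,\dots,y_n=x$ is the unique path from the root to $x$. $L^0(\partial T,E)$ is the space of $M$-measurable functions $h:\partial T\to E$ (that is, $h^{-1}(V)\in M$ for every open $V\subset E$), modulo $\mathbb{P}$-a.e. equality, with the topology of convergence in probability, given by the metric $d_{\mathbb{P}}(h,g)=\int_{\partial T}\frac{d(h(e),g(e))}{1+d(h(e),g(e))}\,d\mathbb{P}(e)$. For $f:T\to E$ and $n\ge 0$, $\omega_n(f):\partial T\to E$ is defined by $\omega_n(f)(e)=f(z)$, where $z$ is the unique element of $e\cap T_n$. Frequent universality. $f\in H(T,E)$ is frequently universal, written $f\in U_{FM}(T,E)$, if for every non-empty open set $V\subset L^0(\partial T,E)$ the set $\{n\in\{0,1,2,\dots\}:\omega_n(f)\in V\}$ has strictly positive lower density (the lower density of $A\subset\{0,1,2,\dots\}$ is $\liminf_{n\to\infty}\frac{|A\cap\{0,\dots,n\}|}{n+1}$).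
   Formalization: The last claim (U_FM(T,E) is disjoint from a dense G_δ subset of H(T,E)) is stated for E ≠ {0}; for E = {0} it fails, since then H(T,E) = U_FM(T,E) = {0}. *)

(* Defs.v *)
From HB Require Import structures.
From mathcomp Require Import all_boot all_order all_algebra finmap.
From mathcomp Require Import all_classical all_reals all_analysis.

Set Implicit Arguments.
Unset Strict Implicit.
Unset Printing Implicit Defensive.

Import Order.TTheory GRing.Theory Num.Theory.

Local Open Scope classical_set_scope.
Local Open Scope ring_scope.

(* No compatibility between the topology and the operations is built into
   preTopologicalFieldType and metric_lmod: the required continuity and
   invariance properties are separate hypotheses. *)
#[short(type="preTopologicalFieldType")]
HB.structure Definition PreTopologicalField :=
  {F of Topological F & GRing.Field F}.

(* This is not a joint HB structure because the library's join of a
   (neighborhood) space and a module requires an ordered ring of scalars. *)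
Record metric_lmod (R : realType) (F : fieldType) := MetricLmod {
  lmod_sort : lmodType F ;
  dist : lmod_sort -> lmod_sort -> R ;
  distxx : forall x, dist x x = 0 ;
  dist_positivity : forall x y, dist x y = 0 -> x = y ;
  dist_sym : forall x y, dist x y = dist y x ;
  dist_triangle : forall y x z, dist x z <= dist x y + dist y z
}.

Section MetricLmodSort.
Context (R : realType) (F : fieldType) (E : metric_lmod R F).

Definition metric_lmod_sort : Type := lmod_sort E.

HB.instance Definition _ := GRing.Lmodule.on metric_lmod_sort.
HB.instance Definition _ := isMetric.Build R metric_lmod_sort
  (@distxx _ _ E) (@dist_positivity _ _ E) (@dist_sym _ _ E)
  (@dist_triangle _ _ E).

End MetricLmodSort.

Coercion metric_lmod_sort : metric_lmod >-> Sortclass.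

Definition separable (X : topologicalType) : Prop :=
  exists2 A : set X, countable A & dense A.

Section Tree.
Local Open Scope fset_scope.

Record rooted_tree := RootedTree {
  vertex :> choiceType ;
  level : nat -> {fset vertex} ;
  tree_root : vertex ;
  children : vertex -> {fset vertex} ;
  level0 : level 0 = [fset tree_root] ;
  level_cover : forall x, exists n, x \in level n ;
  level_disjoint : forall m n x, x \in level m -> x \in level n -> m = n ;
  children_card : forall x, (2 <= #|` children x|)%N ;
  children_level : forall n x, x \in level n -> children x `<=` level n.+1 ;
  children_partition : forall n y, y \in level n.+1 ->
    exists! x, x \in level n /\ y \in children x
}.

End Tree.

Arguments tree_root {r}.

Section Boundary.
Variable T : rooted_tree.

(* A geodesic is represented by its sequence of vertices z; the unique vertex
   of the geodesic in level n is then z n. *)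
Definition rays : set (nat -> T) :=
  [set z | z 0%N = tree_root /\ forall n, z n.+1 \in children (z n)].

Definition boundary : Type := set_type rays.

HB.instance Definition _ := Choice.on boundary.

Lemma child_ex (x : T) : exists y, y \in children x.
Proof.
have := children_card x.
by case: (fset_0Vmem (children x)) => [->|[y yx]]; [rewrite cardfs0|exists y].
Qed.

Definition first_ray (n : nat) : T :=
  iter n (fun x => sval (cid (child_ex x))) tree_root.

Lemma first_rayP : first_ray \in rays.
Proof.
rewrite inE; split=> // n.
by rewrite /first_ray iterS; exact: (svalP (cid (child_ex _))).
Qed.

HB.instance Definition _ := isPointed.Build boundary (SigSub first_rayP).

Definition vertex_at (e : boundary) (n : nat) : T := val e n.

Definition cone (x : T) : set boundary := [set e | exists n, vertex_at e n = x].

Definition level_algebra (n : nat) : set (set boundary) :=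
  <<s [set cone x | x in [set x | x \in level T n]] >>.

Definition boundary_space := g_sigma_algebraType (\bigcup_n level_algebra n).

Lemma ray_level (e : boundary) n : vertex_at e n \in level T n.
Proof.
case: e => z zr; rewrite /vertex_at /=; move: zr; rewrite inE => -[z0 zS].
elim: n => [|n IH]; first by rewrite z0 level0 inE.
exact: (fsubsetP (children_level IH)).
Qed.

Lemma measurable_vertex_at n (A : set T) :
  measurable ([set e | A (vertex_at e n)] : set boundary_space).
Proof.
rewrite (_ : [set _ | _] =
    \bigcup_(x in [set x | x \in level T n] `&` A) (cone x)).
  apply: fin_bigcup_measurable.
    apply: finite_setIl; exact: finite_fset.
  move=> x [xn _]; apply: sub_sigma_algebra; exists n => //.
  by apply: sub_sigma_algebra; exists x.
apply/seteqP; split => e /=.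
  by move=> Ae; exists (vertex_at e n); [split=> //; exact: ray_level|exists n].
move=> [x [xn Ax] [m emx]].
have mn : m = n by apply: (level_disjoint _ xn); rewrite -emx; exact: ray_level.
by rewrite -mn emx.
Qed.

End Boundary.

Section Borel.
Context (R : realType) (F : fieldType) (E : metric_lmod R F).

(* E, pointed at 0 as measurable types are required to be *)
Definition pointed_copy : Type := E.
HB.instance Definition _ := Metric.on pointed_copy.
HB.instance Definition _ := isPointed.Build pointed_copy (0 : E).

Definition borel := g_sigma_algebraType (open : set (set pointed_copy)).

End Borel.

Section Harmonic.
Context (T : rooted_tree) (R : realType) (F : fieldType).
Context (E : metric_lmod R F) (w : T -> T -> F).

Definition harmonic : set (T -> E) :=
  [set f | forall x, f x = \sum_(y <- children x) w x y *: f y].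

Definition harmonic_pred : {pred T -> E} := mem harmonic.

Lemma harmonic_submod_closed : submod_closed harmonic_pred.
Proof.
split; first by rewrite inE => x; rewrite big1// => y _; rewrite scaler0.
move=> a f g; rewrite !inE => fh gh x.
rewrite !fctE fh gh scaler_sumr -big_split/=; apply: eq_bigr => y _.
by rewrite scalerDr !scalerA mulrC.
Qed.

HB.instance Definition _ :=
  GRing.isSubmodClosed.Build F (T -> E) harmonic_pred harmonic_submod_closed.

Definition harmonic_space : Type := {f : T -> E | f \in harmonic_pred}.

HB.instance Definition _ := SubChoice.on harmonic_space.
HB.instance Definition _ :=
  [SubChoice_isSubLmodule of harmonic_space by <:].
HB.instance Definition _ := Topological.copy harmonic_space
  (initial_topology (val : harmonic_space -> {ptws T -> E})).

End Harmonic.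

Section L0.
Context (T : rooted_tree) (R : realType) (F : fieldType).
Context (E : metric_lmod R F) (P : probability (boundary_space T) R).

Definition L0 : Type := {mfun_ P, boundary_space T >-> borel E}.
HB.instance Definition _ := Choice.on L0.

(* h and g are evaluated on representatives of their classes, on which the
   integral does not depend. *)
Definition prob_dist (h g : {mfun_ P, boundary_space T >-> borel E}) : \bar R :=
  (\int[P]_e (mdist (h e : E) (g e) / (1 + mdist (h e : E) (g e)))%:E)%E.

Definition L0_open : set_system L0 :=
  [set V | forall h, V h ->
    exists2 r : R, 0 < r & forall g, (prob_dist h g < r%:E)%E -> V g].

Lemma L0_openT : L0_open setT.
Proof. by move=> h _; exists 1. Qed.

Lemma L0_openI : setI_closed L0_open.
Proof.
move=> A B oA oB h [Ah Bh].
have [r r0 rA] := oA _ Ah; have [s s0 sB] := oB _ Bh.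
exists (Num.min r s) => [|g]; first by rewrite lt_min r0 s0.
by rewrite EFin_min lt_min => /andP[/rA ? /sB ?]; split.
Qed.

Lemma L0_open_bigU (I : Type) (f : I -> set L0) :
  (forall i, L0_open (f i)) -> L0_open (\bigcup_i f i).
Proof.
move=> of_ h [i _ fih]; have [r r0 rf] := of_ _ _ fih.
by exists r => // g /rf fig; exists i.
Qed.

HB.instance Definition _ :=
  isOpenTopological.Build L0 L0_openT L0_openI L0_open_bigU.

Section Omega.
Variables (n : nat) (f : T -> E).

Definition omega_fun (e : boundary_space T) : borel E := f (vertex_at e n).

Lemma measurable_omega_fun : measurable_fun setT omega_fun.
Proof. by move=> _ Y _; rewrite setTI; exact: (measurable_vertex_at n (f @^-1` Y)). Qed.

HB.instance Definition _ :=
  isMeasurableFun.Build _ _ _ _ omega_fun measurable_omega_fun.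

Definition omega : L0 := (\pi_({mfun_ P, boundary_space T >-> borel E})%qT
  (omega_fun : {mfun boundary_space T >-> borel E})).

End Omega.

End L0.

Definition lower_density (R : realType) (A : set nat) : \bar R :=
  limn_einf (fun n =>
    (#|[pred k : 'I_n.+1 | nat_of_ord k \in A]|%:R / n.+1%:R)%:E).

Definition freq_universal (T : rooted_tree) (R : realType) (F : fieldType)
    (E : metric_lmod R F) (w : T -> T -> F)
    (P : probability (boundary_space T) R) : set (harmonic_space E w) :=
  [set f | forall V : set (L0 E P), open V -> V !=set0 ->
    (0 < lower_density R [set n | V (omega P n (val f))])%E].

Arguments freq_universal {T R F} E w P.

(* Main.v *)
Require Import Defs.
From HB Require Import structures.
From mathcomp Require Import all_boot all_order all_algebra finmap.
From mathcomp Require Import all_classical all_reals all_analysis borel_hierarchy.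
From mathcomp Require Import measurable_realfun lra zify.

Set Implicit Arguments.
Unset Strict Implicit.
Unset Printing Implicit Defensive.

Import Order.TTheory GRing.Theory Num.Theory.

Local Open Scope classical_set_scope.
Local Open Scope ring_scope.

(** A harmonic function can be prescribed freely at all children of a vertex but
    one: as the weights are invertible, the value at the last child restores the
    mean value property. Choose as this last child, the heir, one that receives
    at most half of the mass of its parent. If target values are given at depth
    [s + k], let them induce values at the depths between [s] and [s + k] by
    averaging, and aim at these values from depth [s] on ([extension]). A ray
    then misses its target only if it passes to the heir [k] times in a row
    ([agree_off_heirs]), which has probability at most [2 ^- k]
    ([P_heir_rays]). So within [k] levels, whatever the values at depth [s], the
    function comes close in probability to any function of the vertex at a fixed
    depth, and such functions are dense in [L0] ([simple_approximation]).

    To do this for countably many targets with positive frequency, the target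
    number [j] is scheduled at the indices [i] whose exponent of two is [j],
    with [j + 1] levels reserved before the due time. As the exponent of two in
    [i`!] is at most [i], the due time of index [i] is at most [2 * i], so each
    target is met at a set of depths of positive lower density, with error
    probability tending to zero in [j].

    One schedule serves a whole sequence of functions: each task names one
    member and one target, and all other members aim at zero during it. Hence
    in a linear combination only the term of the named member is felt, and every
    combination with a nonzero coefficient is frequently universal
    ([combination_universal]). The members start from arbitrary values in a
    dense sequence at an arbitrary depth, which makes the sequence itself dense
    in the space of harmonic functions ([family_dense]); its span is the
    required vector space.

    If the weights at each vertex sum to one, a nonzero constant [v] is a
    consistent aim at all depths at once, so the functions that converge to [v]
    in probability are dense. They belong to the G-delta set of the functions
    that stay close to [v], with probability at least one half, during
    arbitrarily late and long periods; this keeps the visits to a ball around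
    zero at lower density zero ([long_stays_not_universal]). *)

(** * Levels and parents in the tree *)

Section TreeStructure.
Variable T : rooted_tree.
Implicit Types x y z : T.

Definition depth x : nat := sval (cid (level_cover x)).

Lemma mem_level x : x \in level T (depth x).
Proof. exact: svalP (cid (level_cover x)). Qed.

Lemma depthE x n : x \in level T n -> depth x = n.
Proof. by move=> xn; exact: level_disjoint (mem_level x) xn. Qed.

Lemma depth_child x y : y \in children x -> depth y = (depth x).+1.
Proof.
by move=> yx; apply: depthE; exact: (fsubsetP (children_level (mem_level x))).
Qed.

Lemma parent_uniq x x' y : y \in children x -> y \in children x' -> x = x'.
Proof.
move=> yx yx'.
have xx' : depth x = depth x'.
  by apply: succn_inj; rewrite -(depth_child yx) -(depth_child yx').
have yn : y \in level T (depth x).+1 by rewrite -(depth_child yx) mem_level.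
have [z [_ zu]] := children_partition yn.
have <- : z = x by apply: zu; rewrite mem_level.
by apply: zu; rewrite xx' mem_level.
Qed.

Definition parent y : T :=
  if pselect (exists x, y \in children x) is left yx then sval (cid yx) else y.

Lemma parent_child x y : y \in children x -> parent y = x.
Proof.
move=> yx; rewrite /parent; case: pselect => [h|[]]; last by exists x.
exact: parent_uniq (svalP (cid h)) yx.
Qed.

Lemma mem_children_parent y n : depth y = n.+1 -> y \in children (parent y).
Proof.
move=> yn; have := mem_level y; rewrite yn => /children_partition[x [[_ yx] _]].
by rewrite (parent_child yx).
Qed.

Lemma depth_vertex (e : boundary T) n : depth (vertex_at e n) = n.
Proof. exact/depthE/ray_level. Qed.

Lemma vertex_child (e : boundary T) n :
  vertex_at e n.+1 \in children (vertex_at e n).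
Proof. by case: e => z; rewrite /vertex_at/= inE => -[]. Qed.

Lemma iter_parent_vertex (e : boundary T) k n :
  iter k (@parent) (vertex_at e (k + n)) = vertex_at e n.
Proof.
elim: k => // k IH; rewrite iterSr addSn.
by rewrite (parent_child (vertex_child e (k + n))).
Qed.

(** Paths are finite sequences extended arbitrarily, the form in which the law
    of the boundary is given. *)
Lemma path_to x : exists y : nat -> T, [/\ y 0%N = tree_root,
  forall j, (j < depth x)%N -> y j.+1 \in children (y j) & y (depth x) = x].
Proof.
move nE : (depth x) => n; elim: n x nE => [|n IH] x xn.
  exists (fun=> x); split=> //.
  by have := mem_level x; rewrite xn level0 inE => /eqP.
have xp := mem_children_parent xn.
have pn : depth (parent x) = n.
  by apply: succn_inj; rewrite -xn (depth_child xp).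
have [y [y0 yS yn]] := IH _ pn.
exists (fun j => if (j <= n)%N then y j else x); split=> /=; rewrite ?ltnn//.
move=> j; rewrite ltnS => jn; rewrite jn.
move: jn; rewrite leq_eqVlt => /orP[/eqP->|jn]; first by rewrite ltnn yn.
by rewrite jn; exact: yS.
Qed.

End TreeStructure.

(** * Extending harmonic functions *)

Section Extension.
Context (T : rooted_tree) (F : fieldType) (E : lmodType F) (w : T -> T -> F).
Hypothesis w_neq0 : forall x y, y \in children x -> w x y != 0.
Implicit Types (f g u D : T -> E) (x y z : T).

Definition harmonic_at f x : Prop :=
  f x = \sum_(y <- children x) w x y *: f y.

(** The value at [x] that values [g] given [k] levels below [x] force on a
    harmonic function. *)
Fixpoint mean k g x : E :=
  if k is k'.+1 then \sum_(y <- children x) w x y *: mean k' g y else g x.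

Lemma mean_harmonic f n x : (forall z, (depth z < n)%N -> harmonic_at f z) ->
  (depth x <= n)%N -> mean (n - depth x) f x = f x.
Proof.
move=> fh; move kE : (n - depth x)%N => k.
elim: k x kE => [//|k IH] x xk xn.
have xn' : (depth x < n)%N by rewrite -subn_gt0 xk.
rewrite [RHS]fh//=; apply: eq_big_seq => y yx; congr (_ *: _).
by apply: IH; rewrite (depth_child yx)// subnS xk.
Qed.

Lemma eq_mean k g g' x :
  (forall z, depth z = (depth x + k)%N -> g z = g' z) ->
  mean k g x = mean k g' x.
Proof.
elim: k x => [|k IH] x gg' /=; first by apply: gg'; rewrite addn0.
apply: eq_big_seq => y yx; congr (_ *: _); apply: IH => z zn; apply: gg'.
by rewrite zn (depth_child yx) addnS.
Qed.

Lemma harmonic_atB f g x : harmonic_at f x -> harmonic_at g x ->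
  harmonic_at (fun z => f z - g z) x.
Proof.
rewrite /harmonic_at => -> ->; rewrite -sumrB; apply: eq_bigr => y _.
by rewrite scalerBr.
Qed.

Variable heir : T -> T.
Hypothesis heirP : forall x, heir x \in children x.

(** Values can be prescribed at all children but one: since the remaining
    weight is invertible, the value at the last child, here the [heir], can be
    chosen so that the mean value property holds. *)
Lemma extension N u D : exists f : T -> E, [/\
  forall x, harmonic_at f x,
  forall x, depth x = N -> f x = u x &
  forall x y, y \in children x -> (N <= depth x)%N -> y != heir x ->
    f y = D y].
Proof.
pose fix ext (k : nat) y {struct k} := if k is k'.+1 then
  if y == heir (parent y) then
    (w (parent y) y)^-1 *: (ext k' (parent y) -
      \sum_(z <- children (parent y) | z != y) w (parent y) z *: D z)
  else D y else u y.
pose f x := if (depth x <= N)%N then mean (N - depth x) u x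
            else ext (depth x - N)%N x.
have fge x : (N <= depth x)%N -> f x = ext (depth x - N)%N x.
  rewrite leq_eqVlt /f => /orP[/eqP<-|]; last by rewrite ltnNge => /negbTE->.
  by rewrite leqnn subnn.
have fS x y : y \in children x -> (N <= depth x)%N ->
    f y = if y == heir x then (w x y)^-1 *: (f x -
      \sum_(z <- children x | z != y) w x z *: D z) else D y.
  move=> yx xN; rewrite !fge ?(depth_child yx) ?(leqW xN)// subSn//=.
  by rewrite (parent_child yx).
exists f; split=> [x|x xN|x y yx xN yh].
- rewrite /harmonic_at; case: (ltnP (depth x) N) => xN.
    rewrite {1}/f (ltnW xN) -(subnSK xN)/=; apply: eq_big_seq => y yx.
    by rewrite /f (depth_child yx) xN.
  have hx := heirP x.
  rewrite (bigD1_seq (heir x) hx (fset_uniq _))/=.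
  rewrite (fS _ _ hx)// eqxx scalerA divff ?w_neq0// scale1r.
  rewrite -[LHS](subrK (\sum_(z <- children x | z != heir x) w x z *: D z)).
  congr (_ + _); rewrite big_seq_cond [RHS]big_seq_cond.
  by apply: eq_bigr => y /andP[yx /negbTE yh]; rewrite (fS _ _ yx)// yh.
- by rewrite /f xN leqnn subnn.
- by rewrite (fS _ _ yx)// (negbTE yh).
Qed.

(** The weight of the heir is invertible, so its value is determined by the
    values at [x] and at the other children: agreement is inherited. *)
Lemma agree_children f D x : harmonic_at f x -> harmonic_at D x ->
  f x = D x -> (forall y, y \in children x -> y != heir x -> f y = D y) ->
  forall y, y \in children x -> f y = D y.
Proof.
move=> fh Dh fD fDy y yx; have [->|] := eqVneq y (heir x); last exact: fDy.
have hx := heirP x.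
move: (harmonic_atB fh Dh); rewrite /harmonic_at fD subrr.
rewrite (bigD1_seq (heir x) hx (fset_uniq _))/=.
rewrite big1_seq ?addr0; last first.
  by move=> z /andP[zh zx]; rewrite fDy// subrr scaler0.
move=> /esym/eqP; rewrite scaler_eq0 (negbTE (w_neq0 hx))/=.
by rewrite subr_eq0 => /eqP.
Qed.

Definition heir_rays s k : set (boundary T) :=
  [set e | forall j, (j < k)%N ->
    vertex_at e (s + j).+1 = heir (vertex_at e (s + j))].

(** As soon as a ray leaves the line of heirs it meets a vertex where the
    prescribed value is taken, and agreement is inherited from then on. *)
Lemma agree_off_heirs N f D s k (e : boundary T) :
  (forall x, harmonic_at f x) ->
  (forall x y, y \in children x -> (N <= depth x)%N -> y != heir x ->
    f y = D y) ->
  (N <= s)%N ->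
  (forall x, (s < depth x < s + k)%N -> harmonic_at D x) ->
  ~ heir_rays s k e -> f (vertex_at e (s + k)) = D (vertex_at e (s + k)).
Proof.
move=> fh fD Ns Dh /existsNP[j /not_implyP[jk /eqP ej]].
have /subnKC <- : (s + j < s + k)%N by rewrite ltn_add2l.
have : (s + j + (s + k - (s + j).+1) < s + k)%N.
  by rewrite -addSn subnKC// ltn_add2l.
elim: (_ - _)%N => [_|i IH ik].
  rewrite addn0; apply: fD ej; first exact: vertex_child.
  by rewrite depth_vertex (leq_trans Ns)// leq_addr.
rewrite addnS; apply: (agree_children (x := vertex_at e ((s + j).+1 + i))).
- exact: fh.
- apply: Dh; rewrite depth_vertex addSn ltnS -addnA leq_addr/=.
  by move: ik; rewrite addnS addnA.
- by apply: IH; apply: leq_trans ik; rewrite ltnS leq_add2l.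
- move=> y yx; apply: fD => //; rewrite depth_vertex (leq_trans Ns)//.
  by rewrite addSn -addnS -addnA leq_addr.
- exact: vertex_child.
Qed.

End Extension.
(** * The harmonic measure on the boundary *)

(** A vertex has at least two children, so one of them receives at most half
    of the mass. *)
Lemma light_child (R : realType) (T : rooted_tree) (q : T -> T -> R) (x : T) :
  (forall y, 0 <= q x y) -> \sum_(y <- children x) q x y = 1 ->
  exists2 y, y \in children x & q x y <= 2^-1.
Proof.
move=> q0 q1; have [y1 y1x] := child_ex x.
have : (0 < #|` (children x `\ y1)%fset|)%N.
  by have := children_card x; rewrite (cardfsD1 y1) y1x.
rewrite cardfs_gt0 => /fset0Pn[y2]; rewrite !inE => /andP[y21 y2x].
have [|y1h] := leP (q x y1) 2^-1; first by exists y1.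
exists y2 => //.
move: q1; rewrite (bigD1_seq y1 y1x (fset_uniq _))/=.
rewrite -big_filter (bigD1_seq y2) ?filter_uniq//=; last first.
  by rewrite mem_filter y21.
have : 0 <= \sum_(i <- [seq i <- children x | i != y1] | i != y2) q x i.
  by apply: sumr_ge0.
by move: y1h; lra.
Qed.

Section HarmonicMeasure.
Context (R : realType) (T : rooted_tree) (q : T -> T -> R).
Context (P : probability (boundary_space T) R).
Implicit Types (x y : T) (A B : set (boundary_space T)).

Lemma coneE x : cone x = [set e | vertex_at e (depth x) = x].
Proof.
apply/seteqP; split=> e /=; last by exists (depth x).
by move=> [n ex]; rewrite -ex depth_vertex.
Qed.

Lemma measurable_cone x : measurable (cone x : set (boundary_space T)).
Proof.
by rewrite coneE; exact: (measurable_vertex_at (depth x) [set y | y = x]).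
Qed.

Definition level_set n (S : set T) : set (boundary_space T) :=
  [set e | S (vertex_at e n)].

Lemma measurable_level_set n S : measurable (level_set n S).
Proof. exact: measurable_vertex_at. Qed.

Lemma level_set_deeper k n S :
  level_set n S = level_set (k + n) [set y | S (iter k (@parent T) y)].
Proof.
by apply/seteqP; split=> e; rewrite /level_set/= iter_parent_vertex.
Qed.

Section HeirRays.
Hypothesis P_cone : forall (n : nat) (y : nat -> T), y 0%N = tree_root ->
  (forall j, (j < n)%N -> y j.+1 \in children (y j)) ->
  P (cone (y n)) = (\prod_(j < n) q (y j) (y j.+1))%:E.

Lemma P_child x y : y \in children x ->
  P (cone y) = (P (cone x) * (q x y)%:E)%E.
Proof.
move=> yx; have [p [p0 pS px]] := path_to x.
pose p' j := if (j <= depth x)%N then p j else y.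
have p'n : p' (depth x).+1 = y by rewrite /p' ltnn.
rewrite -[in LHS]p'n -[in RHS]px.
rewrite (P_cone p0 pS) P_cone//; last first.
  move=> j; rewrite ltnS /p' => jx; rewrite jx.
  move: jx; rewrite leq_eqVlt => /orP[/eqP->|jx]; first by rewrite ltnn px.
  by rewrite jx; exact: pS.
rewrite -EFinM; congr EFin; rewrite big_ord_recr/=; congr (_ * _).
  by apply: eq_bigr => j _; rewrite /p' (ltnW (ltn_ord j)) ltn_ord.
by rewrite p'n /p' leqnn px.
Qed.

Hypothesis q_ge0 : forall x y, 0 <= q x y.
Variable heir : T -> T.
Hypothesis heirP : forall x, heir x \in children x.
Hypothesis heir_light : forall x, q x (heir x) <= 2^-1.

Lemma P_iter_heir k x :
  (P (cone (iter k heir x)) <= (2^-1 ^+ k)%:E * P (cone x))%E.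
Proof.
elim: k => [|k IH]; first by rewrite expr0 mul1e.
rewrite iterS (P_child (heirP _)) exprS EFinM -muleA muleC.
by apply: lee_pmul => //; rewrite lee_fin.
Qed.

Lemma measurable_heir_rays s k :
  measurable (heir_rays heir s k : set (boundary_space T)).
Proof.
rewrite (_ : heir_rays heir s k = \bigcap_(j in [set j | (j < k)%N])
    level_set (s + j).+1 [set y | y = heir (parent y)]).
  by apply: bigcap_measurableType => j _; exact: measurable_level_set.
apply/seteqP; split=> e eh j jk; have := eh j jk;
by rewrite /level_set/= (parent_child (vertex_child e (s + j))).
Qed.

(** Each step along the line of heirs costs a factor [2^-1], and the cones at
    depth [s] are disjoint. *)
Lemma P_heir_rays s k : (P (heir_rays heir s k) <= (2^-1 ^+ k)%:E)%E.
Proof.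
pose D := [set x | x \in level T s].
have Dfin : finite_set D by exact: finite_fset.
have cover : heir_rays heir s k `<=` \bigcup_(x in D) cone (iter k heir x).
  move=> e eh; exists (vertex_at e s); first exact: ray_level.
  exists (s + k)%N; elim: k eh => [|k IH] eh; first by rewrite addn0.
  rewrite addnS eh// iterS IH// => j jk; apply: eh; exact: ltnW.
apply: (le_trans (content_sub_fsum P Dfin _ _ cover)).
- by move=> x _; exact: measurable_cone.
- exact: measurable_heir_rays.
apply: (@le_trans _ _ (\sum_(x \in D) (2^-1 ^+ k)%:E * P (cone x))%E).
  by apply: lee_fsum => // x _; exact: P_iter_heir.
rewrite -ge0_mule_fsumr// -measure_fin_bigcup//.
- rewrite -[leRHS]mule1; apply: lee_wpmul2l; first by rewrite lee_fin exprn_ge0.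
  apply: probability_le1; apply: fin_bigcup_measurable => // x _.
  exact: measurable_cone.
- move=> x y /depthE xs /depthE ys [e []]; rewrite !coneE/= xs ys.
  by move=> -> <-.
- by move=> x _; exact: measurable_cone.
Qed.

End HeirRays.

Lemma small_tail (A_ : nat -> set (boundary_space T)) (r : R) : 0 < r ->
  (forall n, measurable (A_ n)) ->
  exists n, (P (\bigcup_k A_ k `\` \big[setU/set0]_(k < n) A_ k) < r%:E)%E.
Proof.
move=> r0 mA; pose B n := \bigcup_k A_ k `\` \big[setU/set0]_(k < n) A_ k.
have mB n : measurable (B n).
  apply: measurableD; first exact: bigcup_measurable.
  exact: bigsetU_measurable.
have B0 : \bigcap_n B n = set0.
  rewrite -subset0 => e eB; have [[k _ Ake] _] := eB 0%N I.
  have [_] := eB k.+1 I; apply; rewrite big_ord_recr/=; by right.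
have := @nonincreasing_cvg_mu _ _ _ P B.
rewrite B0 measure0 => /(_ _ mB).
have B0fin : (P (B 0%N) < +oo)%E.
  by apply: le_lt_trans (probability_le1 P (mB _)) _; rewrite ltry.
have Bni : {homo B : n m / (n <= m)%N >-> (m <= n)%O}.
  move=> n m nm; apply/subsetPset; apply: setDS.
  rewrite -!bigcup_mkord => e [k kn Ake].
  by exists k => //=; exact: leq_trans kn nm.
move=> /(_ B0fin measurable0 Bni) PB.
have : \forall n \near \oo, (P (B n) < r%:E)%E.
  apply: (PB [set x | (x < r%:E)%E]); apply: open_nbhs_nbhs; split => //=.
  exact: open_ereal_lt_ereal.
by case=> N _ PN; exists N; exact: (PN N (leqnn N)).
Qed.

Definition discrepancy A B : set (boundary_space T) :=
  [set e | ~ (A e <-> B e)].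

Lemma measurable_discrepancy A B : measurable A -> measurable B ->
  measurable (discrepancy A B).
Proof.
move=> mA mB; rewrite (_ : discrepancy _ _ = (A `\` B) `|` (B `\` A)).
  by apply: measurableU; exact: measurableD.
apply/seteqP; split=> e; rewrite /discrepancy/=; last by tauto.
by have [Ae|Ae] := pselect (A e); have [Be|Be] := pselect (B e); tauto.
Qed.

Definition approximable A := measurable A /\ forall r : R, 0 < r ->
  exists n S, (P (discrepancy A (level_set n S)) < r%:E)%E.

Lemma P_lt_cover A B C (r s : R) : measurable A -> measurable B ->
  measurable C -> A `<=` B `|` C ->
  (P B < r%:E)%E -> (P C < s%:E)%E -> (P A < (r + s)%:E)%E.
Proof.
move=> mA mB mC ABC Br Cs.
apply: (@le_lt_trans _ _ (P (B `|` C))).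
  by apply: le_measure; rewrite ?inE//; exact: measurableU.
apply: (@le_lt_trans _ _ (P B + P C)%E); first exact: measureU2.
by rewrite EFinD; exact: lteD.
Qed.

Lemma approximableU A B :
  approximable A -> approximable B -> approximable (A `|` B).
Proof.
move=> [mA aA] [mB aB]; split=> [|r r0]; first exact: measurableU.
have r20 : 0 < r / 2 by rewrite divr_gt0.
have [n [S AS]] := aA _ r20; have [m [U BU]] := aB _ r20.
exists (m + n)%N, ([set y | S (iter m (@parent T) y)] `|`
  [set y | U (iter n (@parent T) y)]).
rewrite (splitr r); apply: P_lt_cover AS BU.
- apply: measurable_discrepancy; first exact: measurableU.
  exact: measurable_level_set.
- by apply: measurable_discrepancy => //; exact: measurable_level_set.
- by apply: measurable_discrepancy => //; exact: measurable_level_set.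
- move=> e; rewrite (level_set_deeper m n S) (level_set_deeper n m U) addnC.
  rewrite /discrepancy /level_set/= => ne; apply/not_andP => -[]; tauto.
Qed.

Lemma approximable_bigcup (A_ : nat -> set (boundary_space T)) :
  (forall n, approximable (A_ n)) -> approximable (\bigcup_n A_ n).
Proof.
move=> aA; have mA n : measurable (A_ n) by have [] := aA n.
split=> [|r r0]; first exact: bigcup_measurable.
have r20 : 0 < r / 2 by rewrite divr_gt0.
have [n nA] := small_tail r20 mA.
have [mB /(_ _ r20)[m [S BS]]] : approximable (\big[setU/set0]_(k < n) A_ k).
  elim/big_ind : _ => //; last exact: approximableU.
  split=> // s s0; exists 0%N, set0.
  by rewrite (_ : discrepancy _ _ = set0) ?measure0 ?lte_fin// -subset0 => e [].
exists m, S; rewrite (splitr r); apply: P_lt_cover nA BS => //.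
- apply: measurable_discrepancy; first exact: bigcup_measurable.
  exact: measurable_level_set.
- by apply: measurableD => //; exact: bigcup_measurable.
- by apply: measurable_discrepancy => //; exact: measurable_level_set.
- have sub : \big[setU/set0]_(k < n) A_ k `<=` \bigcup_k A_ k.
    by rewrite -bigcup_mkord; exact: bigcup_subset.
  move=> e; have := sub e; rewrite /discrepancy/=.
  have [Be|Be] := pselect ((\big[setU/set0]_(k < n) A_ k) e); first by tauto.
  by have [|] := pselect ((\bigcup_k A_ k) e); tauto.
Qed.

(** Measurable sets are approximated by events decided at a finite depth: these
    events form an algebra that generates the measurable sets, and the sets
    that they approximate form a sigma-algebra. *)
Lemma measurable_approximable A : measurable A -> approximable A.
Proof.
have sC : sigma_algebra setT approximable.
  split.
  - split=> // r r0; exists 0%N, set0.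
    rewrite (_ : discrepancy _ _ = set0) ?measure0 ?lte_fin//.
    by rewrite -subset0 => e [].
  - move=> B [mB aB]; split=> [|r r0]; first exact: measurableD.
    have [n [S BS]] := aB _ r0; exists n, (~` S).
    rewrite (_ : discrepancy _ _ = discrepancy B (level_set n S))//.
    apply/seteqP; split=> e; rewrite /discrepancy /level_set/=;
      by have [|] := pselect (B e);
         have [|] := pselect (S (vertex_at e n)); tauto.
  - exact: approximable_bigcup.
apply: smallest_sub => // B [n _]; apply: smallest_sub => // _ [x xn <-].
split=> [|r r0]; first exact: measurable_cone.
exists (depth x), [set y | y = x].
rewrite (_ : discrepancy _ _ = set0) ?measure0 ?lte_fin// -subset0 => e.
by rewrite /discrepancy coneE; apply.
Qed.

End HarmonicMeasure.
(** * Separability and convergence in probability *)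

Section BoundedDistance.
Context (R : realType).
Implicit Types s t : R.

Definition bounded t : R := t / (1 + t).

Lemma bounded_ge0 t : 0 <= t -> 0 <= bounded t.
Proof. by move=> t0; rewrite divr_ge0// addr_ge0. Qed.

Lemma bounded_le1 t : 0 <= t -> bounded t <= 1.
Proof. by move=> t0; rewrite ler_pdivrMr ?mul1r; lra. Qed.

Lemma bounded_le t : 0 <= t -> bounded t <= t.
Proof. by move=> t0; rewrite ler_pdivrMr; nra. Qed.

Lemma bounded_mono s t : 0 <= s -> s <= t -> bounded s <= bounded t.
Proof.
move=> s0 st; rewrite /bounded ler_pdivrMr; last lra.
by rewrite mulrAC ler_pdivlMr; nra.
Qed.

Lemma boundedD s t : 0 <= s -> 0 <= t ->
  bounded (s + t) <= bounded s + bounded t.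
Proof.
move=> s0 t0; rewrite /bounded mulrDl lerD// ler_pdivrMr; try lra.
  by rewrite mulrAC ler_pdivlMr; nra.
by rewrite mulrAC ler_pdivlMr; nra.
Qed.

Lemma bounded_lt c t : 0 <= t -> c < 1 -> (bounded t < c) = (t < c / (1 - c)).
Proof.
move=> t0 c1; rewrite ltr_pdivrMr; last lra.
by rewrite ltr_pdivlMr; [apply/idP/idP; nra|lra].
Qed.

End BoundedDistance.

Lemma small_natSinv (R : realType) (r : R) : 0 < r -> exists n, n.+1%:R^-1 < r.
Proof.
move=> r0; have [N _ /(_ N (leqnn N))] := near_infty_natSinv_lt (PosNum r0).
by exists N.
Qed.

Lemma small_half_power (R : realType) (r : R) : 0 < r ->
  exists J, forall j, (J <= j)%N -> 2^-1 ^+ j < r.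
Proof.
move=> r0; have [J Jr] := small_natSinv r0.
exists J => j Jj; apply: le_lt_trans Jr.
rewrite exprVn lef_pV2 ?posrE ?exprn_gt0// -natrX ler_nat.
by apply: leq_trans (ltn_expl j _); rewrite ?ltnS.
Qed.

Section MetricSpace.
Context (R : realType) (X : metricType R).

Lemma metric_ball_open (x : X) (r : R) : open (ball x r).
Proof.
rewrite openE => y; rewrite ballEmdist/= => xy.
apply/nbhs_ballP; exists (r - mdist x y); rewrite /= ?subr_gt0// => z.
rewrite !ballEmdist/= => yz.
have := metric_triangle x y z; lra.
Qed.

Lemma dense_sequence (x0 : X) : separable X ->
  exists ds : nat -> X, forall x (r : R), 0 < r -> exists i, mdist x (ds i) < r.
Proof.
move=> [A /countable_injP[num inj] Ad].
pose ds i : X := if pselect (exists x, A x /\ num x = i) is left xi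
  then sval (cid xi) else x0.
exists ds => x r r0.
have /Ad : ball x r !=set0 by exists x; exact: ballxx.
move=> /(_ (metric_ball_open x r))[z [xz Az]]; exists (num z).
move: xz; rewrite ballEmdist/= /ds.
case: pselect => [h|[]]; last by exists z.
by have [Ay /inj->] := svalP (cid h); rewrite ?inE.
Qed.

End MetricSpace.

Section MeasurableDistance.
Context (R : realType) (F : fieldType) (E : metric_lmod R F).
Hypothesis E_separable : separable E.
Context d (Omega : measurableType d).
Implicit Types h g : {mfun Omega >-> borel E}.

Lemma measurable_mdist_const_lt h (x : E) (r : R) :
  measurable [set e | mdist (h e : E) x < r].
Proof.
rewrite (_ : [set _ | _] = h @^-1` (ball (x : pointed_copy E) r)); last first.
  by apply/seteqP; split=> e /=; rewrite ballEmdist/= metric_sym.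
rewrite -[X in measurable X]setTI; apply: (measurable_funPT h) => //.
by apply: sub_gen_smallest; exact: metric_ball_open.
Qed.

(** Separability makes the distance of two random points measurable: a strict
    upper bound for it is always witnessed, through the triangle inequality, by
    a member of the dense sequence. *)
Lemma measurable_mdist_lt h g (c : R) :
  measurable [set e | mdist (h e : E) (g e) < c].
Proof.
have [ds dsP] := dense_sequence (0 : E) E_separable.
rewrite (_ : [set _ | _] = \bigcup_i \bigcup_n
    ([set e | mdist (h e : E) (ds i) < n.+1%:R^-1] `&`
     [set e | mdist (g e : E) (ds i) < c - n.+1%:R^-1])).
  do 2 (apply: bigcup_measurable => ? _).
  by apply: measurableI; exact: measurable_mdist_const_lt.
apply/seteqP; split=> e /=.
  rewrite -subr_gt0 => hg.
  have [n nP] : exists n, n.+1%:R^-1 < (c - mdist (h e : E) (g e)) / 2.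
    by apply: small_natSinv; rewrite divr_gt0.
  have n0 : 0 < n.+1%:R^-1 :> R by rewrite invr_gt0.
  have [i hi] := dsP (h e) _ n0.
  exists i => //; exists n => //; split=> //=.
  have tri := metric_triangle (g e : E) (h e) (ds i).
  rewrite (metric_sym (g e : E) (h e)) in tri.
  have aux (a b x y : R) : y < (c - a) / 2 -> b < y -> x <= a + b -> x < c - y.
    by lra.
  exact: aux nP hi tri.
move=> [i _ [n _ [/= hi gi]]].
have tri := metric_triangle (h e : E) (ds i) (g e).
rewrite (metric_sym (ds i) (g e)) in tri.
have aux (a b x y : R) : b < y -> x < c - y -> a <= b + x -> a < c by lra.
exact: aux hi gi tri.
Qed.

Lemma measurable_bounded_mdist h g :
  measurable_fun setT ((fun e => bounded (mdist (h e : E) (g e))) : Omega -> R).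
Proof.
apply: (measurability (@RGenInftyO.G R)); [exact: RGenInftyO.measurableE|].
move=> _ [_ [c ->] <-]; rewrite setTI.
have [c1|c1] := ltP c 1.
  rewrite (_ : _ @^-1` _ = [set e | mdist (h e : E) (g e) < c / (1 - c)]).
    exact: measurable_mdist_lt.
  by apply/seteqP; split=> e; rewrite /= in_itv/= bounded_lt// mdist_ge0.
rewrite (_ : _ @^-1` _ = setT)//; apply/seteqP; split=> e //= _.
rewrite in_itv/=; apply: lt_le_trans c1.
have t0 := mdist_ge0 (h e : E) (g e); rewrite /bounded ltr_pdivrMr; lra.
Qed.

End MeasurableDistance.

Section ProbDist.
Context (R : realType) (T : rooted_tree) (F : fieldType) (E : metric_lmod R F).
Context (P : probability (boundary_space T) R).
Hypothesis E_separable : separable E.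
Implicit Types h g k : {mfun_ P, boundary_space T >-> borel E}.
Local Notation dist h g e := (mdist (h e : E) (g e)).

Let int_ge0 h g e : (0 <= (bounded (dist h g e))%:E)%E.
Proof. by rewrite lee_fin bounded_ge0// mdist_ge0. Qed.

Let int_mes h g : measurable_fun [set: boundary_space T]
  ((fun e => (bounded (dist h g e))%:E) : boundary_space T -> \bar R).
Proof.
apply/measurable_EFinP.
exact: (measurable_bounded_mdist _ (repr h) (repr g)).
Qed.

Lemma prob_dist_triangle h g k :
  (prob_dist h k <= prob_dist h g + prob_dist g k)%E.
Proof.
rewrite /prob_dist -ge0_integralD//; first last.
- exact: int_mes.
- by move=> e _; exact: int_ge0.
- exact: int_mes.
- by move=> e _; exact: int_ge0.
apply: ge0_le_integral => //.
- by move=> e _; exact: int_ge0.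
- exact: int_mes.
- by apply: emeasurable_funD; exact: int_mes.
- move=> e _; rewrite -EFinD lee_fin.
  apply: le_trans (boundedD (mdist_ge0 _ _) (mdist_ge0 _ _)).
  by apply: bounded_mono; [exact: mdist_ge0|exact: metric_triangle].
Qed.

Lemma prob_dist_le h g (B : set (boundary_space T)) (r : R) :
  measurable B -> 0 <= r -> (forall e, ~ B e -> dist h g e <= r) ->
  (prob_dist h g <= r%:E + P B)%E.
Proof.
move=> mB r0 hg.
apply: (@le_trans _ _ (\int[P]_e (r%:E + (\1_B e)%:E))%E).
  apply: ge0_le_integral => //.
  - by move=> e _; exact: int_ge0.
  - exact: int_mes.
  - by apply: emeasurable_funD => //; exact/measurable_EFinP/measurable_indic.
  - move=> e _; rewrite -EFinD lee_fin indicE.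
    have [eB|] := boolP (e \in B).
      by rewrite -[leLHS]add0r lerD// bounded_le1// mdist_ge0.
    rewrite notin_setE addr0 => /hg; apply: le_trans.
    by rewrite bounded_le// mdist_ge0.
rewrite ge0_integralD//; last exact/measurable_EFinP/measurable_indic.
- rewrite integral_cst// integral_indic// setIT.
  by rewrite [X in (_ * X)%E]probability_setT mule1.
Qed.

Lemma prob_dist_ge h g (B : set (boundary_space T)) (c : R) :
  measurable B -> 0 <= c -> (forall e, B e -> c <= dist h g e) ->
  ((bounded c)%:E * P B <= prob_dist h g)%E.
Proof.
move=> mB c0 hg.
apply: (@le_trans _ _ (\int[P]_e ((bounded c)%:E * (\1_B e)%:E))%E).
  rewrite ge0_integralZl//.
  - by rewrite integral_indic// setIT.
  - exact/measurable_EFinP/measurable_indic.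
  - by rewrite lee_fin bounded_ge0.
apply: ge0_le_integral => //.
- by move=> e _; rewrite -EFinM lee_fin mulr_ge0// bounded_ge0.
- by apply: measurable_funeM; exact/measurable_EFinP/measurable_indic.
- exact: int_mes.
- move=> e _; rewrite -EFinM lee_fin indicE.
  have [|_] := boolP (e \in B); last by rewrite mulr0 bounded_ge0// mdist_ge0.
  by rewrite inE mulr1 => /hg; exact: bounded_mono.
Qed.

Lemma L0_ball_open h (r : R) :
  open ([set g | (prob_dist h g < r%:E)%E] : set (L0 E P)).
Proof.
move=> g /= hg.
have gfin : prob_dist h g \is a fin_num.
  rewrite ge0_fin_numE; last first.
    by apply: integral_ge0 => e _; exact: int_ge0.
  by apply: lt_trans hg _; rewrite ltry.
exists (r - fine (prob_dist h g)).
  by rewrite subr_gt0 -lte_fin fineK.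
move=> k gk; apply: le_lt_trans (prob_dist_triangle h g k) _.
rewrite -[in ltLHS](fineK gfin).
have -> : r%:E = ((fine (prob_dist h g))%:E + (r - fine (prob_dist h g))%:E)%E.
  by rewrite -EFinD addrC subrK.
by rewrite lteD2lE.
Qed.

Lemma omega_off_null n (f : T -> E) : exists Z : set (boundary_space T),
  [/\ measurable Z, P Z = 0 &
      forall e, ~ Z e ->
        (omega P n f : {mfun_ P, _ >-> borel E}) e = f (vertex_at e n)].
Proof.
have : repr (omega P n f) = (@omega_fun T R F E n f) %[ae P].
  by have /eqmodP/asboolP := reprK (omega P n f).
move=> [Z [mZ PZ ZP]]; exists Z; split=> // e Ze.
by apply: contrapT => h; apply: Ze; apply: ZP => /(_ I).
Qed.

(** Finitely many balls around members of a dense sequence carry almost all of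
    the law of [h], and each of the corresponding events is almost decided at a
    finite depth; hence functions of the vertex at a fixed depth are dense. *)
Lemma simple_approximation h (ds : nat -> E) (r : R) :
  (forall x (s : R), 0 < s -> exists i, mdist x (ds i) < s) -> 0 < r ->
  exists K (s : T -> nat) (B : set (boundary_space T)),
    [/\ measurable B, (P B < r%:E)%E &
        forall e, ~ B e -> mdist (h e : E) (ds (s (vertex_at e K))) < r].
Proof.
move=> dsP r0; pose A i := [set e | mdist (h e : E) (ds i) < r].
have mA i : measurable (A i : set (boundary_space T)).
  exact: (measurable_mdist_const_lt (repr h)).
have r20 : 0 < r / 2 by rewrite divr_gt0.
have [n nA] := small_tail P r20 mA.
have : exists K (s : T -> nat) (B : set (boundary_space T)),
    [/\ measurable B, (P B < (r / 2)%:E)%E &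
        forall e, ~ B e -> (\big[setU/set0]_(i < n) A i) e ->
          A (s (vertex_at e K)) e].
  move: (r / 2) r20 => {nA} r' r'0; elim: n r' r'0 => [|n IH] r' r'0.
    exists 0%N, (fun=> 0%N), set0.
    split=> //; first by rewrite measure0 lte_fin.
    by move=> e _; rewrite big_ord0.
  have r'20 : 0 < r' / 2 by rewrite divr_gt0.
  have [K [s [B [mB PB sB]]]] := IH _ r'20.
  have [_ /(_ _ r'20)[m [S SP]]] := measurable_approximable P (mA n).
  have mD := measurable_discrepancy (mA n) (measurable_level_set m S).
  exists (m + K)%N, (fun y => if pselect (S (iter K (@parent T) y)) then n
                              else s (iter m (@parent T) y)).
  exists (B `|` discrepancy (A n) (level_set m S)); split.
  - exact: measurableU.
  - by rewrite (splitr r'); apply: P_lt_cover PB SP => //; exact: measurableU.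
  - move=> e /not_orP[Be /contrapT AS].
    rewrite iter_parent_vertex addnC iter_parent_vertex big_ord_recr/=.
    case: pselect => [/AS//|Se [Ae|/AS//]]; exact: sB.
move=> [K [s [B [mB PB sB]]]].
exists K, s, (B `|` (\bigcup_k A k `\` \big[setU/set0]_(k < n) A k)).
have mT : measurable (\bigcup_k A k `\` \big[setU/set0]_(k < n) A k).
  apply: measurableD; first exact: bigcup_measurable.
  exact: bigsetU_measurable.
split.
- exact: measurableU.
- by rewrite (splitr r); apply: P_lt_cover PB nA => //; exact: measurableU.
- move=> e /not_orP[Be Te]; apply: sB => //; apply: contrapT => nAe.
  by apply: Te; split=> //; have [i hi] := dsP (h e) _ r0; exists i.
Qed.

End ProbDist.
(** * A schedule in which every task recurs with positive density *)

(** If [j] is the exponent of two in [i], the time [due i] is reserved for task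
    [j], and the [j + 1] units of time before it for the preparation of this
    task; the preparation thus gets longer with [j] and every task recurs. *)
Fixpoint due i : nat :=
  if i is i'.+1 then (due i' + (logn 2 i'.+1).+1)%N else 0%N.

Lemma due_mono : {homo due : i j / (i < j)%N}.
Proof.
apply: homo_ltn => [|i] /=; first exact: ltn_trans.
by rewrite addnS ltnS leq_addr.
Qed.

Lemma due_leq : {homo due : i j / (i <= j)%N}.
Proof. exact: ltnW_homo due_mono. Qed.

Lemma leq_due i : (i <= due i)%N.
Proof. by elim: i => //= i IH; rewrite addnS ltnS (leq_trans IH)// leq_addr. Qed.

(** The preparation times of the first [i] tasks add up to [i] plus the
    exponent of two in [i`!], which is at most [i] by Legendre's formula. *)
Lemma due_leq_double i : (due i <= 2 * i)%N.
Proof.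
have -> : due i = (logn 2 i`! + i)%N.
  elim: i => [|i /= ->]; first by rewrite fact0 logn1.
  by rewrite factS lognM ?fact_gt0// [RHS]addnC; lia.
rewrite mul2n -addnn leq_add2r logn_fact//.
(* Halving repeatedly leaves a remainder that pays for the omitted terms. *)
suff H m : (\sum_(1 <= k < m.+1) i %/ 2 ^ k + i %/ 2 ^ m <= i)%N.
  exact: leq_trans (leq_addr _ _) (H i).
elim: m => [|m IH]; first by rewrite big_geq// expn0 divn1.
rewrite big_nat_recr//= -addnA; apply: leq_trans IH; rewrite leq_add2l.
by rewrite expnSr divnMA addnn -muln2; exact: leq_trunc_div.
Qed.

Lemma due_between i j n :
  (due i < n <= due i.+1)%N -> (due j < n <= due j.+1)%N -> i = j.
Proof.
move=> /andP[i1 i2] /andP[j1 j2].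
have [ij|ij|//] := ltngtP i j; move: (due_leq ij) => h.
  by have := leq_trans (leq_trans j1 i2) h; rewrite ltnn.
by have := leq_trans (leq_trans i1 j2) h; rewrite ltnn.
Qed.

Section LowerDensity.
Variable R : realType.
Implicit Type A : set nat.

Definition frequency A n : R :=
  #|[pred k : 'I_n.+1 | nat_of_ord k \in A]|%:R / n.+1%:R.

Lemma lower_density_gt0P A : (0 < lower_density R A)%E <->
  exists2 c : R, 0 < c & exists N, forall n, (N <= n)%N -> c <= frequency A n.
Proof.
rewrite /lower_density limn_einf_lim (cvg_lim _ (@cvg_einfs_sup _ _))//.
split=> [/ereal_sup_gt[_ [N _ <-]]|[c c0 [N cN]]].
  move=> c0; have cn n : (N <= n)%N ->
      (ereal_inf [set (frequency A k)%:E | k in [set k | (N <= k)%N]] <=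
       (frequency A n)%:E)%E.
    by move=> Nn; apply: ereal_inf_lbound; exists n.
  move: c0 cn; rewrite /einfs/= /sdrop.
  case: (ereal_inf _) => [c c0 cn|_ cn|//].
    by exists c => //; exists N => n /cn.
  by have := cn _ (leqnn N); rewrite leNgt ltry.
apply: (@lt_le_trans _ _ c%:E); first by rewrite lte_fin.
apply: (@le_trans _ _ (einfs (fun n => (frequency A n)%:E) N)); last first.
  by apply: ereal_sup_ubound; exists N.
by apply: le_ereal_inf_tmp => _ [n Nn <-]; rewrite lee_fin; exact: cN.
Qed.

(** The indices [2 ^ j * odd] have density [2 ^- (j + 1)], and [due] at most
    doubles them. *)
Lemma recurring_lower_density A j l0 :
  (forall l, (l0 <= l)%N -> A (due (2 ^ j * l.*2.+1))) ->
  (0 < lower_density R A)%E.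
Proof.
move=> Al; pose M := (2 ^ j.+2)%N.
have M0 : (0 < M)%N by rewrite expn_gt0.
apply/lower_density_gt0P; exists (2 * M)%:R^-1.
  by rewrite invr_gt0 ltr0n muln_gt0.
exists (2 * M * l0.+1)%N => n nM.
have count : (n %/ M - l0 <= #|[pred k : 'I_n.+1 | nat_of_ord k \in A]|)%N.
  pose f (i : 'I_(n %/ M - l0)) : 'I_n.+1 :=
    inord (due (2 ^ j * (l0 + i).*2.+1)).
  have fE i : f i = due (2 ^ j * (l0 + i).*2.+1) :> nat.
    rewrite inordK// ltnS (leq_trans (due_leq_double _))//.
    apply: (@leq_trans (M * (n %/ M))); last by rewrite mulnC leq_trunc_div.
    have := ltn_ord i; rewrite ltn_subRL;
    move: (l0 + i)%N => a; move: (n %/ M)%N => b.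
    have -> : M = (4 * 2 ^ j)%N by rewrite /M !expnS; lia.
    move: (2 ^ j)%N => p; nia.
  have finj : injective f.
    move=> i k /(congr1 val); rewrite /= !fE => due_eq; apply/val_inj => /=.
    have step (a b : nat) : (a < b)%N ->
        (due (2 ^ j * (l0 + a).*2.+1) < due (2 ^ j * (l0 + b).*2.+1))%N.
      by move=> ab; apply: due_mono; rewrite ltn_pmul2l ?expn_gt0//; lia.
    by have [/step|/step|//] := ltngtP i k; rewrite due_eq ltnn.
  rewrite -[X in (X <= _)%N]card_ord -(card_codom finj).
  apply: subset_leq_card; apply/fintype.subsetP => _ /codomP[i ->].
  by rewrite !inE fE; apply: Al; rewrite leq_addr.
rewrite /frequency ler_pdivlMr// mulrC ler_pdivrMr; last first.
  by rewrite ltr0n muln_gt0.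
rewrite -natrM ler_nat; apply: leq_trans (leq_mul count (leqnn _)).
have := divn_eq n M; have := ltn_pmod n M0.
move: (n %/ M)%N (n %% M)%N => a b; clearbody M; nia.
Qed.

(** At the end [n * m] of a gap, at most [m] of the times so far lie in [A]. *)
Lemma gaps_lower_density A :
  (forall n, exists2 m, (n <= m)%N & forall k, (m <= k <= n * m)%N -> ~ A k) ->
  ~ (0 < lower_density R A)%E.
Proof.
move=> gaps /lower_density_gt0P[c c0 [N cN]].
have [n nc] := small_natSinv c0.
have [m mn Am] := gaps (N + n.+1)%N.
have /cN : (N <= (N + n.+1) * m)%N by lia.
rewrite leNgt => /negP; apply; apply: le_lt_trans nc.
rewrite /frequency ler_pdivrMr// mulrC ler_pdivlMr// -natrM ler_nat.
apply: (@leq_trans (m * n.+1)); last by lia.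
rewrite leq_mul2r/=.
pose f (k : 'I_m) : 'I_((N + n.+1) * m).+1 := inord k.
rewrite -[X in (_ <= X)%N](card_ord m).
apply: leq_trans (leq_image_card f _); apply: subset_leq_card.
apply/fintype.subsetP => k; rewrite !inE => kA.
have km : (k < m)%N.
  rewrite ltnNge; apply/negP => mk; move: kA; apply: Am.
  by rewrite mk -ltnS ltn_ord.
apply/codomP; exists (Ordinal km); apply/val_inj; rewrite /f /= inordK//.
Qed.

End LowerDensity.

(** * The space of harmonic functions *)

Section HarmonicTopology.
Context (T : rooted_tree) (R : realType) (F : fieldType) (E : metric_lmod R F).
Variable w : T -> T -> F.
Local Notation H := (harmonic_space E w).

Lemma harmonic_spaceP (f : H) x : harmonic_at w (val f) x.
Proof. by have := valP f; rewrite inE; apply. Qed.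

(** Every basic neighbourhood constrains finitely many vertices, hence only the
    vertices up to some depth. *)
Lemma dense_harmonic (S : set H) :
  (forall (f : H) N (r : R), 0 < r -> exists2 g, S g &
    forall x, (depth x <= N)%N -> mdist (val f x : E) (val g x) < r) ->
  dense S.
Proof.
move=> approx O [f Of] [U oU UO].
have /choice[g gP] (n : nat) : exists g, S g /\
    forall x, (depth x <= n)%N -> mdist (val f x : E) (val g x) < n.+1%:R^-1.
  have [|g Sg gf] := approx f n n.+1%:R^-1; first by rewrite invr_gt0.
  by exists g.
have gf : (fun n => val (g n)) @ \oo --> (val f : {ptws T -> E}).
  apply/cvg_sup => x A [V] [[B oB <-] Bf BA].
  have /nbhs_ballP[r r0 rB] : nbhs (val f x) B by exact: open_nbhs_nbhs.
  have [N Nr] := small_natSinv r0.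
  exists (maxn N (depth x)) => // n /=; rewrite geq_max => /andP[Nn xn].
  apply: BA; apply: rB; rewrite ballEmdist/=.
  apply: lt_trans ((gP n).2 x xn) _; apply: le_lt_trans Nr.
  by rewrite lef_pV2 ?posrE// ler_nat ltnS.
have [N _ /(_ N (leqnn N)) gU] : \forall n \near \oo, U (val (g n)).
  by apply: gf; apply: open_nbhs_nbhs; split=> //; move: Of; rewrite -UO.
by exists (g N); split; [rewrite -UO|exact: (gP N).1].
Qed.

Lemma open_eval_close x (v : E) (r : R) :
  open [set f : H | mdist v (val f x : E) < r].
Proof.
rewrite (_ : [set f | _] = val @^-1` (proj x @^-1` (ball v r))); last first.
  by apply/seteqP; split=> f /=; rewrite ballEmdist.
exists (proj x @^-1` (ball v r)) => //.
have /continuousP evalc : continuous (proj x : {ptws T -> E} -> E).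
  exact: (@proj_continuous T (fun=> E)).
by apply: evalc; exact: metric_ball_open.
Qed.

End HarmonicTopology.
(** ** Dependence of a harmonic function on its values at one level *)

Section MeanContinuity.
Context (T : rooted_tree) (R : realType) (F : fieldType) (E : metric_lmod R F).
Variable w : T -> T -> F.
Hypothesis E_invariant : forall x y z : E, mdist (x + z) (y + z) = mdist x y.
Hypothesis E_scale : forall (a : F) (x : E) (r : R), 0 < r ->
  exists2 s : R, 0 < s & forall y, mdist x y < s -> mdist (a *: x) (a *: y) < r.
Implicit Types (g u : T -> E) (x y z : T).

Lemma mdist_add (a b c d : E) (r s : R) :
  mdist a b < r -> mdist c d < s -> mdist (a + c) (b + d) < r + s.
Proof.
move=> ab cd; apply: le_lt_trans (metric_triangle _ (b + c) _) _.
rewrite E_invariant (addrC b c) (addrC b d) E_invariant.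
exact: ltrD.
Qed.

Lemma mean_close k g x (r : R) : 0 < r -> exists2 s : R, 0 < s & forall u,
  (forall z, depth z = (depth x + k)%N -> mdist (g z) (u z) < s) ->
  mdist (mean w k g x) (mean w k u x) < r.
Proof.
elim: k x r => [|k IH] x r r0.
  by exists r => // u gu; apply: gu; rewrite addn0.
have [s s0 sP] : exists2 s : R, 0 < s & forall u,
    (forall z, depth z = (depth x + k.+1)%N -> mdist (g z) (u z) < s) ->
    mdist (\sum_(y <- children x | y \in children x) w x y *: mean w k g y)
          (\sum_(y <- children x | y \in children x) w x y *: mean w k u y) < r.
  elim: (enum_fset (children x)) r r0 => [|y ys IHys] r r0.
    by exists 1 => // u _; rewrite !big_nil mdistxx.
  have r20 : 0 < r / 2 by rewrite divr_gt0.
  have [s1 s10 s1P] := IHys _ r20.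
  have [s2 s20 s2P] := E_scale (w x y) (mean w k g y) r20.
  have [s3 s30 s3P] := IH y _ s20.
  exists (Num.min s1 s3) => [|u gu]; first by rewrite lt_min s10.
  have gu1 z : depth z = (depth x + k.+1)%N -> mdist (g z) (u z) < s1.
    by move=> /gu; rewrite lt_min => /andP[].
  rewrite !big_cons; case: ifPn => [yx|_]; last first.
    by apply: lt_trans (s1P u gu1) _; rewrite [ltRHS]splitr ltrDl.
  rewrite (splitr r); apply: mdist_add; last exact: s1P.
  apply: s2P; apply: s3P => z; rewrite (depth_child yx) addSnnS => /gu.
  by rewrite lt_min => /andP[].
by exists s => // u /sP; rewrite -!big_seq.
Qed.

Lemma means_close N g (r : R) : 0 < r -> exists2 s : R, 0 < s & forall u,
  (forall z, depth z = N -> mdist (g z) (u z) < s) ->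
  forall x, (depth x <= N)%N ->
    mdist (mean w (N - depth x) g x) (mean w (N - depth x) u x) < r.
Proof.
move=> r0.
pose xs := flatten [seq enum_fset (level T n) | n <- iota 0 N.+1].
have [s s0 sP] : exists2 s : R, 0 < s & forall u,
    (forall z, depth z = N -> mdist (g z) (u z) < s) ->
    forall x, x \in xs -> (depth x <= N)%N ->
      mdist (mean w (N - depth x) g x) (mean w (N - depth x) u x) < r.
  elim: xs => [|y ys [s s0 IH]]; first by exists 1.
  have [s' s'0 s'P] := mean_close (N - depth y) g y r0.
  exists (Num.min s s') => [|u gu x]; first by rewrite lt_min s0.
  rewrite in_cons => /predU1P[->|xys] xN.
    by apply: s'P => z; rewrite subnKC// => /gu; rewrite lt_min => /andP[].
  by apply: IH => // z /gu; rewrite lt_min => /andP[].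
exists s => // u gu x xN; apply: sP => //.
by apply/flatten_mapP; exists (depth x); rewrite ?mem_iota ?mem_level.
Qed.

End MeanContinuity.

(** * A countable family of universal functions *)

Section UniversalFamily.
Context (T : rooted_tree) (R : realType) (F : fieldType) (E : metric_lmod R F).
Variable w : T -> T -> F.
Hypothesis w_neq0 : forall x y, y \in children x -> w x y != 0.
Hypothesis E_invariant : forall x y z : E, mdist (x + z) (y + z) = mdist x y.
Hypothesis E_scale : forall (a : F) (x : E) (r : R), 0 < r ->
  exists2 s : R, 0 < s & forall y, mdist x y < s -> mdist (a *: x) (a *: y) < r.
Variable ds : nat -> E.
Hypothesis ds_dense : forall x (r : R), 0 < r -> exists i, mdist x (ds i) < r.
Variables (heir : T -> T) (heirP : forall x, heir x \in children x).
Local Notation H := (harmonic_space E w).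

(** The functions on a level with values in the dense sequence have countably
    many codes; they serve both as initial values and as targets. *)
Definition level_fun (c : nat * seq nat) : T -> E :=
  fun z => ds (nth 0%N c.2 (index z (level T c.1))).

Definition code_of N (s : T -> nat) : nat * seq nat :=
  (N, [seq s z | z <- enum_fset (level T N)]).

Lemma level_fun_code N (s : T -> nat) z :
  depth z = N -> level_fun (code_of N s) z = ds (s z).
Proof.
move=> zN; rewrite /level_fun/=.
have zN' : z \in enum_fset (level T N) by rewrite -zN; exact: mem_level.
by rewrite (nth_map z) ?index_mem// nth_index.
Qed.

(** Task [i] concerns the member [a] of the family and the target coded by [c]
    if the exponent [j] of two in [i] is such that the exponent of two in
    [j + 1] is the rank of [(a, c)]; in this way every pair occurs for
    infinitely many exponents [j]. *)
Definition task i : option (nat * (nat * seq nat)) :=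
  choice.unpickle (logn 2 (logn 2 i).+1).

Definition target a i z : E :=
  if task i is Some (b, c) then
    if a == b then level_fun c (iter (depth z - c.1) (@parent T) z) else 0
  else 0.

(** Between two due times, the values that the next target forces on the
    earlier levels. *)
Definition plan a z : E :=
  let i := xget 0%N [set i | (due i < depth z <= due i.+1)%N] in
  mean w (due i.+1 - depth z) (target a i.+1) z.

Lemma planE a i z : (due i < depth z <= due i.+1)%N ->
  plan a z = mean w (due i.+1 - depth z) (target a i.+1) z.
Proof.
move=> zi; rewrite /plan (_ : xget _ _ = i)//.
by case: xgetP => [j _ /= zj|/(_ i)//]; exact: due_between zj zi.
Qed.

Lemma plan_harmonic a i x : (due i < depth x < due i.+1)%N ->
  harmonic_at w (plan a) x.
Proof.
move=> /andP[ix xi]; rewrite /harmonic_at (@planE _ i) ?ix ?(ltnW xi)//.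
rewrite -(subnSK xi) [LHS]/=; apply: eq_big_seq => y yx.
by rewrite (@planE _ i) (depth_child yx)// (ltn_trans ix).
Qed.

Definition initial a : nat * seq nat := odflt (0%N, [::]) (choice.unpickle a).

Definition follows_plan a (f : H) : Prop :=
  (forall x, depth x = (initial a).1 -> val f x = level_fun (initial a) x) /\
  (forall x y, y \in children x -> ((initial a).1 <= depth x)%N ->
     y != heir x -> val f y = plan a y).

Lemma family_exists : exists fam : nat -> H, forall a, follows_plan a (fam a).
Proof.
suff /choice[fam famP] : forall a, exists f, follows_plan a f by exists fam.
move=> a.
have [f [fh fN fp]] := extension w_neq0 heirP (initial a).1
  (level_fun (initial a)) (plan a).
have fH : f \in harmonic_pred w by rewrite inE.
by exists (exist _ f fH); split.
Qed.

Section Family.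
Variable fam : nat -> H.
Hypothesis famP : forall a, follows_plan a (fam a).

Lemma family_dense (f : H) N (r : R) : 0 < r -> exists a, forall x,
  (depth x <= N)%N -> mdist (val f x : E) (val (fam a) x) < r.
Proof.
move=> r0.
have [s s0 sP] := means_close w E_invariant E_scale N (val f) r0.
have /choice[t tP] z := ds_dense (val f z) s0.
exists (choice.pickle (code_of N t)) => x xN.
set a := choice.pickle _; have ia : initial a = code_of N t.
  by rewrite /initial choice.pickleK.
have meanE (g : H) : mean w (N - depth x) (val g) x = val g x.
  by apply: mean_harmonic xN => z _; exact: harmonic_spaceP.
rewrite -[X in mdist X _]meanE -[X in mdist _ X]meanE; apply: sP => // z zN.
by have [-> ] := famP a; rewrite ia// level_fun_code.
Qed.

(** The members of the family that are not concerned by a task aim at zero, so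
    that near its due time only one term of a linear combination is felt. *)
Lemma family_hits (s : T -> nat) b K A J : exists j, (J <= j)%N /\
  exists l0, forall l, (l0 <= l)%N ->
    let i := (2 ^ j * l.*2.+1)%N in
    exists2 i0, due i = (due i0 + j.+1)%N &
    forall a (e : boundary T), (a < A)%N -> ~ heir_rays heir (due i0) j.+1 e ->
      val (fam a) (vertex_at e (due i)) =
        if a == b then ds (s (vertex_at e K)) else 0.
Proof.
have logn2 p m : logn 2 (2 ^ p * m.*2.+1) = p.
  by rewrite lognM ?expn_gt0// pfactorK// lognE/= dvdn2 /= odd_double addn0.
pose p := choice.pickle (b, code_of K s).
have jE : (2 ^ p * J.*2.+1).-1.+1 = (2 ^ p * J.*2.+1)%N.
  by rewrite prednK// muln_gt0 expn_gt0.
exists (2 ^ p * J.*2.+1).-1; set j := (_.-1) in jE *; split.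
  by rewrite -ltnS jE; have : (0 < 2 ^ p)%N by [rewrite expn_gt0]; nia.
exists (K + \max_(a < A) (initial a).1)%N => l l0 i.
have i0 : (0 < i)%N by rewrite muln_gt0 expn_gt0.
have ij : logn 2 i = j by rewrite logn2.
have il : (l < i)%N.
  by rewrite /i; have : (0 < 2 ^ j)%N by [rewrite expn_gt0]; nia.
clearbody i; case: i i0 ij il => // i _ ij il.
have dueE : due i.+1 = (due i + j.+1)%N by rewrite /= ij.
have l0i : (K + \max_(a < A) (initial a).1 <= due i)%N.
  by apply: leq_trans (leq_due i); exact: leq_trans l0 il.
have iK : (K <= due i.+1)%N.
  by rewrite dueE (leq_trans _ (leq_addr _ _))// (leq_trans _ l0i)// leq_addr.
exists i => // a e aA eh; have [_ fp] := famP a.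
have ia : ((initial a).1 <= due i)%N.
  apply: leq_trans l0i; apply: leq_trans (leq_addl _ _).
  exact: (leq_bigmax (Ordinal aA)).
have fh := harmonic_spaceP (fam a).
rewrite dueE (agree_off_heirs w_neq0 heirP fh fp ia _ eh).
  rewrite -dueE (@planE _ i); last first.
    by rewrite depth_vertex leqnn dueE addnS ltnS leq_addr.
  rewrite depth_vertex subnn -[mean _ _ _ _]/(target a i.+1 _) /target /task.
  rewrite ij jE logn2 choice.pickleK depth_vertex; case: eqP => // _.
  rewrite -{2}(subnK iK) iter_parent_vertex level_fun_code//.
  exact: depth_vertex.
by move=> x; rewrite -dueE; exact: plan_harmonic.
Qed.

End Family.
End UniversalFamily.
(** * Universality of linear combinations *)

Section Combinations.
Context (T : rooted_tree) (R : realType) (F : fieldType) (E : metric_lmod R F).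
Variable w : T -> T -> F.
Local Notation H := (harmonic_space E w).
Implicit Types (c : nat -> F) (fam : nat -> H).

Lemma val_combination c fam n x :
  val (\sum_(a < n) c a *: fam a) x = \sum_(a < n) c a *: val (fam a) x :> E.
Proof.
elim: n => [|n IH]; first by rewrite !big_ord0.
by rewrite !big_ord_recr/= -IH.
Qed.

Definition combinations fam : set H :=
  [set f | exists c n, (forall a, (n <= a)%N -> c a = 0) /\
                       f = \sum_(a < n) c a *: fam a].

Lemma combination_widen c fam n m :
  (forall a, (n <= a)%N -> c a = 0) -> (n <= m)%N ->
  \sum_(a < n) c a *: fam a = \sum_(a < m) c a *: fam a.
Proof.
move=> c0 nm; rewrite (big_ord_widen _ (fun a => c a *: fam a) nm).
rewrite big_mkcond/=; apply: eq_bigr => a _; case: ltnP => // na.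
by rewrite c0// scale0r.
Qed.

Lemma combinations_submod fam : submod_closed (mem (combinations fam)).
Proof.
split; first by rewrite inE; exists (fun=> 0), 0%N; rewrite big_ord0.
move=> k f g; rewrite !inE => -[c [n [c0 ->]]] [d [m [d0 ->]]].
exists (fun a => k * c a + d a), (maxn n m); split.
  by move=> a; rewrite geq_max => /andP[/c0-> /d0->]; rewrite mulr0 addr0.
rewrite (combination_widen fam c0 (leq_maxl n m)).
rewrite (combination_widen fam d0 (leq_maxr n m)).
rewrite scaler_sumr -big_split/=; apply: eq_bigr => a _.
by rewrite scalerDl scalerA.
Qed.

Lemma member_combination fam a :
  fam a = \sum_(b < a.+1) (b == a :> nat)%:R *: fam b.
Proof.
rewrite big_ord_recr/= eqxx scale1r big1 ?add0r// => b _.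
by rewrite (ltn_eqF (ltn_ord b)) scale0r.
Qed.

Lemma mem_combinations fam a : combinations fam (fam a).
Proof.
exists (fun b => (b == a)%:R), a.+1; split; last exact: member_combination.
move=> b; rewrite ltnNge leq_eqVlt => /norP[/negbTE+ _].
by rewrite eq_sym => ->.
Qed.

End Combinations.

Section Universality.
Context (T : rooted_tree) (R : realType) (F : fieldType) (E : metric_lmod R F).
Variables (w : T -> T -> F) (q : T -> T -> R).
Context (P : probability (boundary_space T) R).
Hypothesis w_neq0 : forall x y, y \in children x -> w x y != 0.
Hypothesis E_separable : separable E.
Hypothesis E_scale : forall (a : F) (x : E) (r : R), 0 < r ->
  exists2 s : R, 0 < s & forall y, mdist x y < s -> mdist (a *: x) (a *: y) < r.
Hypothesis q_ge0 : forall x y, 0 <= q x y.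
Hypothesis P_cone : forall (n : nat) (y : nat -> T), y 0%N = tree_root ->
  (forall j, (j < n)%N -> y j.+1 \in children (y j)) ->
  P (cone (y n)) = (\prod_(j < n) q (y j) (y j.+1))%:E.
Variable ds : nat -> E.
Hypothesis ds_dense : forall x (r : R), 0 < r -> exists i, mdist x (ds i) < r.
Variables (heir : T -> T) (heirP : forall x, heir x \in children x).
Hypothesis heir_light : forall x, q x (heir x) <= 2^-1.
Local Notation H := (harmonic_space E w).
Variable fam : nat -> H.
Hypothesis famP : forall a, follows_plan ds heir a (fam a).

(** At the due times of a task that concerns [b] and the target [s], the
    combination equals [c b] times the target off the line of heirs. Multiples
    by [c b != 0] of a dense sequence are dense, so that these values
    approximate every random element. *)
Lemma combination_universal (c : nat -> F) n b : (b < n)%N -> c b != 0 ->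
  freq_universal E w P (\sum_(a < n) c a *: fam a).
Proof.
move=> bn cb0 V oV [h Vh].
have [r r0 rV] := oV h Vh.
have r40 : 0 < r / 4 by rewrite divr_gt0.
have cds x (s : R) : 0 < s -> exists i, mdist x (c b *: ds i) < s.
  move=> s0; have [t t0 tP] := E_scale (c b) ((c b)^-1 *: x) s0.
  have [i /tP] := ds_dense ((c b)^-1 *: x) t0.
  by rewrite scalerA divff// scale1r; exists i.
have [K [s [B [mB PB sB]]]] :=
  simple_approximation h cds r40.
have [J Jr] := small_half_power r40.
have [j [Jj [l0 jl]]] := family_hits w_neq0 heirP famP s b K n J.
apply: (@recurring_lower_density _ _ j l0) => l /jl[i0 -> hit] /=.
set f := \sum_(a < n) _.
have [Z [mZ PZ fZ]] := omega_off_null P (due i0 + j.+1) (val f).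
apply: rV; pose L := heir_rays heir (due i0) j.+1 : set (boundary_space T).
have mL : measurable L by exact: measurable_heir_rays.
have PL : (P L < (r / 4)%:E)%E.
  apply: le_lt_trans (P_heir_rays P_cone q_ge0 heirP heir_light _ _) _.
  by rewrite lte_fin; apply: Jr; exact: leq_trans Jj _.
have mLZ : measurable (L `|` Z) by exact: measurableU.
have PZr : (P Z < (r / 4)%:E)%E by rewrite PZ lte_fin.
have PLZ : (P (L `|` Z) < (r / 4 + r / 4)%:E)%E by exact: P_lt_cover PL PZr.
have PBLZ : (P (B `|` (L `|` Z)) < (r / 4 + (r / 4 + r / 4))%:E)%E.
  by apply: P_lt_cover PB PLZ => //; exact: measurableU.
apply: (@le_lt_trans _ _ ((r / 4)%:E + P (B `|` (L `|` Z)))%E).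
  apply: prob_dist_le => //; first exact: measurableU.
    exact: ltW.
  move=> e /not_orP[Be /not_orP[Le Ze]]; rewrite fZ// val_combination.
  rewrite (bigD1 (Ordinal bn))//= hit// eqxx big1 ?addr0; last first.
    move=> a ab; rewrite hit// ifN ?scaler0//.
  exact/ltW/sB.
rewrite [ltRHS](_ : _ = (r / 4)%:E + (r / 4 + (r / 4 + r / 4))%:E)%E.
  by rewrite lteD2lE.
by rewrite -EFinD; congr EFin; lra.
Qed.

Lemma combinations_universal :
  combinations fam `<=` freq_universal E w P `|` [set 0].
Proof.
move=> f [c [n [_ ->]]].
have [/existsP[b cb]|/existsPn c0] := boolP [exists b : 'I_n, c b != 0].
  by left; exact: combination_universal (ltn_ord b) cb.
right; apply: big1 => a _; have := c0 a; rewrite negbK => /eqP->.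
exact: scale0r.
Qed.

Lemma family_universal a : freq_universal E w P (fam a).
Proof.
rewrite (member_combination fam a).
apply: (@combination_universal (fun b => (b == a)%:R) _ a) => //.
by rewrite eqxx oner_eq0.
Qed.

End Universality.
(** * Generic functions are not frequently universal *)

Lemma open_forall_seq (X : topologicalType) (I : eqType) (s : seq I)
    (Q : I -> set X) : (forall i, i \in s -> open (Q i)) ->
  open [set x | forall i, i \in s -> Q i x].
Proof.
elim: s => [|i s IH] oQ.
  by rewrite (_ : [set _ | _] = setT); [exact: openT|apply/seteqP; split].
rewrite (_ : [set _ | _] = Q i `&` [set x | forall j, j \in s -> Q j x]).
  apply: openI; first by apply: oQ; rewrite mem_head.
  by apply: IH => j js; apply: oQ; rewrite in_cons js orbT.
apply/seteqP; split=> x /=.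
  move=> Qx; split; first by apply: Qx; rewrite mem_head.
  by move=> j js; apply: Qx; rewrite in_cons js orbT.
by move=> [Qi Qs] j; rewrite in_cons => /predU1P[->|/Qs].
Qed.

Section Generic.
Context (T : rooted_tree) (R : realType) (F : fieldType) (E : metric_lmod R F).
Variables (w : T -> T -> F) (q : T -> T -> R).
Context (P : probability (boundary_space T) R).
Hypothesis w_neq0 : forall x y, y \in children x -> w x y != 0.
Hypothesis w_sum : forall x, \sum_(y <- children x) w x y = 1.
Hypothesis E_separable : separable E.
Hypothesis q_ge0 : forall x y, 0 <= q x y.
Hypothesis P_cone : forall (n : nat) (y : nat -> T), y 0%N = tree_root ->
  (forall j, (j < n)%N -> y j.+1 \in children (y j)) ->
  P (cone (y n)) = (\prod_(j < n) q (y j) (y j.+1))%:E.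
Variables (heir : T -> T) (heirP : forall x, heir x \in children x).
Hypothesis heir_light : forall x, q x (heir x) <= 2^-1.
Variables (v : E) (r : R).
Hypothesis r0 : 0 < r.
Hypothesis vr : r + r <= mdist v 0.
Local Notation H := (harmonic_space E w).

(** A function is close to [v] at the vertices of a set of probability at least
    one half. This involves finitely many values of the function, so that it is
    an open condition. *)
Definition mostly_close k : set H := [set f | exists2 S : set T,
  ((2^-1)%:E <= P (level_set k S))%E &
  forall x, x \in enum_fset (level T k) -> S x -> mdist v (val f x : E) < r].

Definition long_stays : set H := \bigcap_n \bigcup_(m in [set m | (n <= m)%N])
  [set f | forall k, k \in iota m (n * m).+1 -> mostly_close k f].

Lemma mostly_close_open k : open (mostly_close k).
Proof.
rewrite (_ : mostly_close k =
    \bigcup_(S in [set S : set T | ((2^-1)%:E <= P (level_set k S))%E])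
    [set f : H | forall x, x \in enum_fset (level T k) -> S x ->
       mdist v (val f x : E) < r]).
  apply: bigcup_open => S _.
  apply: (@open_forall_seq _ _ _
    (fun x => [set f : H | S x -> mdist v (val f x : E) < r])) => x _.
  have [Sx|Sx] := pselect (S x).
    rewrite (_ : [set f | _] = [set f : H | mdist v (val f x : E) < r]).
      exact: open_eval_close.
    by apply/seteqP; split=> f /= fv; [exact: fv|move=> _].
  rewrite (_ : [set f | _] = setT); first exact: openT.
  by apply/seteqP; split=> f _ // /Sx.
by apply/seteqP; split=> f [S PS fS]; exists S.
Qed.

Lemma long_stays_Gdelta : Gdelta long_stays.
Proof.
eexists; last by [].
move=> n; apply: bigcup_open => m _.
by apply: (@open_forall_seq _ _ _ mostly_close) => k _; exact: mostly_close_open.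
Qed.

(** Since the weights at each vertex sum to one, the constant [v] is harmonic;
    a harmonic function that aims at [v] from some depth on converges to it in
    probability. *)
Lemma long_stays_dense : dense long_stays.
Proof.
apply: dense_harmonic => f N s s0.
have [g0 [gh gN gv]] := extension w_neq0 heirP N (val f) (fun=> v).
have gH : g0 \in harmonic_pred w by rewrite inE.
exists (exist _ g0 gH : H); last first.
  move=> x xN; rewrite [X in mdist _ X](_ : _ = val f x) ?mdistxx//=.
  rewrite -(mean_harmonic (fun z _ => gh z) xN).
  rewrite -[RHS](mean_harmonic (fun z _ => harmonic_spaceP f z) xN).
  by apply: eq_mean => z; rewrite subnKC//; exact: gN.
move=> n _; exists (maxn n N.+1); first exact: leq_maxl.
move=> k; rewrite mem_iota geq_max => /andP[/andP[_ Nk] _].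
exists [set x | g0 x = v]; last by move=> x _ /= ->; rewrite mdistxx.
have vh x : harmonic_at w (fun=> v) x.
  by rewrite /harmonic_at -scaler_suml w_sum scale1r.
pose L : set (boundary_space T) := heir_rays heir N (k - N).
have mL : measurable L by exact: measurable_heir_rays.
have PL : (P L <= (2^-1)%:E)%E.
  apply: le_trans (P_heir_rays P_cone q_ge0 heirP heir_light _ _) _.
  rewrite lee_fin -[leRHS]expr1 ler_wiXn2l ?subn_gt0//; lra.
apply: (@le_trans _ _ (P (~` L))).
  rewrite probability_setC// leeBrDr//; last first.
    by rewrite ge0_fin_numE// (le_lt_trans PL)// ltry.
  rewrite [leRHS](_ : _ = (2^-1)%:E + (2^-1)%:E)%E ?leeD2l//.
  by rewrite -EFinD; congr EFin; lra.
apply: le_measure; rewrite ?inE.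
- exact: measurableC.
- exact: measurable_level_set.
- move=> e Le; rewrite /level_set/= -(subnKC (ltnW Nk)).
  exact: (agree_off_heirs w_neq0 heirP gh gv (leqnn N) (fun x _ => vh x) Le).
Qed.

(** Being within [r] of [v], which is at distance at least [2 r] from zero, with
    probability at least one half keeps a random element away from a ball around
    zero in [L0]. *)
Lemma long_stays_not_universal : freq_universal E w P `&` long_stays = set0.
Proof.
rewrite -subset0 => f [fU fG].
pose z0 : L0 E P := omega P 0 (fun=> 0 : E).
pose V : set (L0 E P) := [set g | (prob_dist z0 g < (bounded r / 2)%:E)%E].
have br : 0 < bounded r by rewrite divr_gt0// addr_gt0.
have Vz0 : V z0.
  apply: (@le_lt_trans _ _ (0%:E + P set0)%E).
    by apply: prob_dist_le => // e _; rewrite mdistxx.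
  by rewrite measure0 adde0 lte_fin divr_gt0.
have oV : open V by exact: L0_ball_open.
have := fU V oV (ex_intro _ _ Vz0).
apply: gaps_lower_density => n; have [m nm fm] := fG n I.
exists m => // k /andP[mk knm] /=.
have [|S PS fS] := fm k.
  by rewrite mem_iota mk/= addnS ltnS (leq_trans knm)// leq_addl.
have [Z [mZ PZ fZ]] := omega_off_null P k (val f).
have [Z0 [mZ0 PZ0 fZ0]] := omega_off_null P 0 (fun=> 0 : E).
apply/negP; rewrite -leNgt EFinM.
pose B := level_set k S `\` (Z `|` Z0).
have mU : measurable (Z `|` Z0) by exact: measurableU.
have mB : measurable B by apply: measurableD => //; exact: measurable_level_set.
have PB : ((2^-1)%:E <= P B)%E.
  apply: (le_trans PS); apply: (@le_trans _ _ (P (B `|` (Z `|` Z0)))).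
    apply: le_measure; rewrite ?inE//; first exact: measurable_level_set.
      exact: measurableU.
    move=> e Se; have [ZU|ZU] := pselect ((Z `|` Z0) e); first by right.
    by left.
  apply: le_trans; first exact: measureU2.
  rewrite [X in (_ + X)%E](_ : _ = 0%E) ?adde0//.
  apply/eqP; rewrite -measure_le0; apply: le_trans; first exact: measureU2.
  by rewrite [leLHS](_ : _ = 0%E)// -[RHS]adde0; congr (_ + _)%E.
apply: (@le_trans _ _ ((bounded r)%:E * P B)%E).
  by rewrite lee_wpmul2l// lee_fin ltW.
apply: prob_dist_ge => //; first exact: ltW.
move=> e [Se /not_orP[Ze Z0e]]; rewrite fZ// fZ0//.
have fe : mdist v (val f (vertex_at e k) : E) < r.
  by apply: fS => //; exact: ray_level.
have tri := metric_triangle v (val f (vertex_at e k) : E) 0.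
rewrite (metric_sym (val f _ : E)) in tri.
have aux (a b c : R) : r + r <= a -> b < r -> a <= b + c -> r <= c by lra.
exact: aux vr fe tri.
Qed.

End Generic.

Theorem theorem3 (R : realType) (T : rooted_tree)
  (F : preTopologicalFieldType)
  (F_separable : separable F)
  (F_hausdorff : hausdorff_space F)
  (F_add : continuous (fun z : F * F => z.1 + z.2))
  (F_inv : {within [set x : F | x != 0], continuous (fun x : F => x^-1)})
  (E : metric_lmod R F)
  (E_separable : separable E)
  (E_invariant : forall x y z : E, mdist (x + z) (y + z) = mdist x y)
  (E_add : continuous (fun z : E * E => z.1 + z.2))
  (E_scale : continuous (fun z : F * E => z.1 *: z.2))
  (w : T -> T -> F)
  (w_neq0 : forall x y, y \in children x -> w x y != 0)
  (q : T -> T -> R)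
  (q_ge0 : forall x y, 0 <= q x y)
  (q_gt0 : forall x y, (0 < q x y) = (y \in children x))
  (q_sum : forall x, \sum_(y <- children x) q x y = 1)
  (P : probability (boundary_space T) R)
  (P_cone : forall (n : nat) (y : nat -> T), y 0%N = tree_root ->
    (forall j, (j < n)%N -> y j.+1 \in children (y j)) ->
    P (cone (y n)) = (\prod_(j < n) q (y j) (y j.+1))%:E) :
  dense (freq_universal E w P) /\
  ((forall x, \sum_(y <- children x) w x y = 1) ->
    (exists W : set (harmonic_space E w),
      [/\ submod_closed (mem W), dense W &
          W `<=` freq_universal E w P `|` [set 0]]) /\
    ((exists v : E, v != 0) ->
      exists G : set (harmonic_space E w),
        [/\ Gdelta G, dense G & freq_universal E w P `&` G = set0])).

Proof.
have scale_close (a : F) (x : E) (r : R) : 0 < r -> exists2 s : R, 0 < s &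
    forall y : E, mdist x y < s -> mdist (a *: x) (a *: y) < r.
  move=> r0.
  have /nbhs_ballP[s s0 sP] : nbhs x [set y : E | mdist (a *: x) (a *: y) < r].
    have pairx : (fun y : E => (a, y)) @ x --> (a, x).
      apply: (@cvg_pair _ _ _ (nbhs x) (nbhs a) (nbhs x) _ _ _ (fun=> a) id).
        exact: cvg_cst.
      exact: cvg_id.
    have /= cx := cvg_comp _ _ pairx (E_scale (a, x)).
    have := cx _ (nbhsx_ballx (a *: x) r r0).
    by rewrite ballEmdist.
  by exists s => // y xy; apply: sP; rewrite ballEmdist.
have /choice[heir heirq] (x : T) : exists y, y \in children x /\ q x y <= 2^-1.
  by have [y yx qy] := light_child (q_ge0 x) (q_sum x); exists y.
have heirP x : heir x \in children x by have [] := heirq x.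
have heir_light x : q x (heir x) <= 2^-1 by have [] := heirq x.
have [ds dsP] := dense_sequence (0 : E) E_separable.
have [fam famP] := family_exists w_neq0 ds heirP.
have famU := family_universal w_neq0 E_separable scale_close q_ge0 P_cone dsP
  heirP heir_light famP.
have fam_dense (S : set (harmonic_space E w)) :
    (forall a, S (fam a)) -> dense S.
  move=> Sfam; apply: dense_harmonic => f N r r0.
  have [a fa] := family_dense E_invariant scale_close dsP famP f N r0.
  by exists (fam a).
split; first exact: fam_dense.
move=> w_sum; split.
  exists (combinations fam); split.
  - exact: combinations_submod.
  - by apply: fam_dense => a; exact: mem_combinations.
  - exact (combinations_universal w_neq0 E_separable scale_close q_ge0 P_cone
      dsP heirP heir_light famP).
move=> [v v0].
have r0 : 0 < mdist v 0 / 2 by rewrite divr_gt0// mdist_gt0.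
have vr : mdist v 0 / 2 + mdist v 0 / 2 <= mdist v 0 by rewrite -splitr.
exists (long_stays P v (mdist v 0 / 2)); split.
- exact: long_stays_Gdelta.
- exact (long_stays_dense w_neq0 w_sum q_ge0 P_cone heirP heir_light v r0).
- exact: (long_stays_not_universal w P E_separable r0 vr).
Qed.
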